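(* Let $p\ge 3$ be a prime. (1) Let $q=p^n$ and $q'=p^e$ with $e,n$ positive integers such that $e<n$ and $e\mid n$, let $d=(q-1)/(q'-1)$, and let $a,b\in \mathbf{F}_{q'}^*=\mathbf{F}_{q'}\setminus\{0\}$. Then the set of $\mathbf{F}_q$-rational points of the Fermat curve defined by $aX^d+bY^d+Z^d=0$, i.e. the set $\{(x:y:z)\in\mathbf{P}^2(\mathbf{F}_q): ax^d+by^d+z^d=0\}$, is a complete $(k,d)$-arc in $\mathbf{P}^2(\mathbf{F}_q)$, where $k=d(q-d+2)$. (2) Let $q$ be a power of $p$. Then the set of $\mathbf{F}_q$-rational points of the Fermat curve defined by $X^{q-1}+Y^{q-1}=2Z^{q-1}$, i.e. the set $\{(x:y:z)\in\mathbf{P}^2(\mathbf{F}_q): x^{q-1}+y^{q-1}=2z^{q-1}\}$, is a complete $((q-1)^2,q-1)$-arc in $\mathbf{P}^2(\mathbf{F}_q)$.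
   Context: $\mathbf{F}_q$ denotes the finite field with $q$ elements; for $e\mid n$, $\mathbf{F}_{p^e}$ is regarded as a subfield of $\mathbf{F}_{p^n}$. A $(k,d)$-arc in the projective plane $\mathbf{P}^2(\mathbf{F}_q)$ is a set $\mathcal{K}$ of exactly $k$ points of $\mathbf{P}^2(\mathbf{F}_q)$ such that no line of $\mathbf{P}^2(\mathbf{F}_q)$ meets $\mathcal{K}$ in more than $d$ points. A $(k,d)$-arc is called complete if it is not contained in any $(k+1,d)$-arc of $\mathbf{P}^2(\mathbf{F}_q)$. *)

(* Defs.v *)
From HB Require Import structures.
From mathcomp Require Import all_boot all_order all_algebra.

Set Implicit Arguments.
Unset Strict Implicit.
Unset Printing Implicit Defensive.

Import GRing.Theory VectorInternalTheory.
Local Open Scope ring_scope.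

HB.instance Definition _ (F : finFieldType) (vT : vectType F) :=
  [Countable of {vspace vT} by <:].
HB.instance Definition _ (F : finFieldType) (vT : vectType F) :=
  [Finite of {vspace vT} by <:].

(* The points and the lines of P^2(F) are the subspaces of F^3 of dimension
   1 and 2 respectively; incidence is inclusion. *)
Definition proj_point (F : finFieldType) : Type :=
  {U : {vspace 'rV[F]_3} | \dim U == 1%N}.

HB.instance Definition _ (F : finFieldType) := Finite.on (proj_point F).

Definition proj_line (F : finFieldType) : Type :=
  {U : {vspace 'rV[F]_3} | \dim U == 2%N}.

Definition on_line (F : finFieldType) (P : proj_point F) (L : proj_line F) :
  bool := (val P <= val L)%VS.

Definition is_arc (F : finFieldType) (k d : nat) (K : {set proj_point F}) :
  Prop :=
  #|K| = k /\
  forall L : proj_line F, (#|[set P in K | on_line P L]| <= d)%N.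

Definition complete_arc (F : finFieldType) (k d : nat)
  (K : {set proj_point F}) : Prop :=
  is_arc k d K /\
  forall K' : {set proj_point F}, is_arc k.+1 d K' -> ~ K \subset K'.

Definition coords (F : finFieldType) (x y z : F) : 'rV[F]_3 :=
  \row_(j < 3) [:: x; y; z]`_j.

(* P = (x : y : z); this forces (x, y, z) != 0 because P has dimension 1. *)
Definition has_coords (F : finFieldType) (P : proj_point F) (x y z : F) :
  bool := val P == <[coords x y z]>%VS.

(* { (x : y : z) in P^2(F) | E x y z }, for a homogeneous equation E *)
Definition rational_points (F : finFieldType) (E : F -> F -> F -> bool) :
  {set proj_point F} :=
  [set P | [exists x, exists y, exists z, has_coords P x y z && E x y z]].

(* Main.v *)
Require Import Defs.
From HB Require Import structures.
From mathcomp Require Import all_boot all_order all_algebra all_field.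
From mathcomp Require Import ring zify.

(** Both curves are diagonal, [Q = \sum_i A_i X_i^d], with [d] prime to [p].

    On a line, choose a basis [u], [w] with [u_0 = 0] and [w_j = 0 <> u_j]: the
    coefficients of [1], [X] and [X^d] in [Q(u X + w)] cannot all vanish, so the
    line carries at most [d] points of the curve.

    For completeness, every point [g] off the curve must lie on a line with [d]
    points of the curve, and lines through a vertex [e_i] of the coordinate
    triangle suffice. In (1), [x^d] is the norm to [F_q'], each nonzero element
    of [F_q'] has [d] preimages, and the line through [e_i] and [g] works as
    soon as [Q(g) - A_i g_i^d <> 0]; the sum of these three values is [2 Q(g)],
    which is nonzero. In (2) the curve is the complement of the triangle, and a
    line through exactly one vertex has [q - 1] points on it. *)

Set Implicit Arguments.
Unset Strict Implicit.
Unset Printing Implicit Defensive.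

Import GRing.Theory.
Local Open Scope ring_scope.

(** * Points of the plane as spans of nonzero vectors *)

Lemma proj_pointP (F : finFieldType) (P : proj_point F) :
  exists2 v : 'rV[F]_3, v != 0 & val P = <[v]>%VS.
Proof.
case: P => U /= dimU; have U0: U != 0%VS by rewrite -dimv_eq0 (eqP dimU).
exists (vpick U); first by rewrite vpick0.
apply/esym/eqP; rewrite eqEdim -memvE memv_pick (eqP dimU) dim_vline.
by rewrite vpick0 U0.
Qed.

(** Totality lets [pt] serve in [partition_big] and in images of sets; at the zero vector, which
    spans no point, the map built here takes the default [P0]. *)
Lemma proj_point_map (F : finFieldType) :
  exists pt : 'rV[F]_3 -> proj_point F,
    forall v, v != 0 -> val (pt v) = <[v]>%VS.
Proof.
have ptv (v : 'rV[F]_3) : v != 0 -> exists P : proj_point F, val P = <[v]>%VS.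
  move=> v0; have dv: \dim <[v]> == 1%N by rewrite dim_vline v0.
  by exists (exist (fun U : {vspace _} => \dim U == 1%N) _ dv).
have [|P0 _] := ptv (const_mx 1).
  by apply/eqP=> /rowP/(_ 0); rewrite !mxE => /eqP; rewrite oner_eq0.
exists (fun v => odflt P0 [pick P : proj_point F | val P == <[v]>%VS]) => v v0.
case: pickP => [P /eqP // | noP].
by have [P /eqP] := ptv v v0; rewrite noP.
Qed.

Lemma line_eqP (F : finFieldType) (u v : 'rV[F]_3) :
  v != 0 -> reflect (exists2 c, c != 0 & v = c *: u) (<[u]> == <[v]>)%VS.
Proof.
move=> v0; apply: (iffP eqP) => [eq_uv | [c c0 ->]].
  have /vlineP[c vE]: v \in <[u]>%VS by rewrite eq_uv memv_line.
  by exists c => //; apply: contraNneq v0 => c0; rewrite vE c0 scale0r.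
apply/eqP; rewrite eqEsubv -!memvE rpredZ ?memv_line // andbT.
by rewrite -[X in X \in _](scalerK c0) rpredZ ?memv_line.
Qed.

Lemma coords_eta (F : finFieldType) (v : 'rV[F]_3) :
  v = coords (v 0 0) (v 0 1) (v 0 2%:R).
Proof.
apply/rowP=> i; rewrite mxE; case: i => [[|[|[|//]]] lti] /=;
  by congr (v 0 _); apply: val_inj.
Qed.

(** * Diagonal forms, their curves and the affine cone *)

Definition diag_form (F : finFieldType) (A : 'I_3 -> F) d (v : 'rV[F]_3) : F :=
  \sum_i A i * v 0 i ^+ d.

(** Any vector spanning [P] may serve as the witness [v]: by homogeneity the vanishing of the form
    does not depend on the choice, which is [mem_diag_curve]. *)
Definition diag_curve (F : finFieldType) (A : 'I_3 -> F) d :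
  {set proj_point F} :=
  [set P | [exists v : 'rV[F]_3, (val P == <[v]>%VS) && (diag_form A d v == 0)]].

Section Diagonal.

Variables (F : finFieldType) (A : 'I_3 -> F) (d : nat).
Local Notation Q := (diag_form A d).

Lemma diag_formZ c v : Q (c *: v) = c ^+ d * Q v.
Proof.
rewrite /diag_form mulr_sumr; apply: eq_bigr => i _.
by rewrite mxE exprMn mulrCA.
Qed.

Lemma mem_diag_curve (P : proj_point F) v :
  v != 0 -> val P = <[v]>%VS -> (P \in diag_curve A d) = (Q v == 0).
Proof.
move=> v0 Pv; rewrite inE; apply/existsP/idP => [[w]|Qv]; last first.
  by exists v; rewrite Pv eqxx.
case/andP=> /eqP; rewrite Pv => /esym/eqP/(line_eqP _ v0)[c c0 ->] /eqP Qw.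
by rewrite diag_formZ Qw mulr0.
Qed.

Lemma rational_points_diag (E : F -> F -> F -> bool) :
  (forall x y z, E x y z = (Q (coords x y z) == 0)) ->
  rational_points E = diag_curve A d.
Proof.
move=> EQ; apply/setP=> P; rewrite !inE.
apply/existsP/existsP=> [[x /existsP[y /existsP[z /andP[Pv Ev]]]] | [v]].
  by exists (coords x y z); rewrite -EQ Ev andbT.
case/andP=> Pv Qv.
exists (v 0 0); apply/existsP; exists (v 0 1); apply/existsP; exists (v 0 2%:R).
by rewrite /has_coords EQ -coords_eta Pv.
Qed.

(** A point has [#|F| - 1] nonzero representatives, the unit multiples of one of them. The product
    form avoids a division and reduces the point count to counting zeros in the affine cone. *)
Lemma card_diag_curve :
  (#|diag_curve A d| * #|F|.-1)%N =
    #|[set v : 'rV[F]_3 | (v != 0) && (Q v == 0)]|.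
Proof.
have [pt ptE] := proj_point_map F.
rewrite -[RHS]sum1_card (partition_big pt (mem (diag_curve A d))) /=; last first.
  by move=> v; rewrite inE => /andP[v0 Qv]; rewrite (mem_diag_curve v0 (ptE v v0)).
rewrite -sum_nat_const; apply: eq_bigr => P PC.
have [u u0 Pu] := proj_pointP P.
have Qu: Q u == 0 by rewrite -(mem_diag_curve u0 Pu).
rewrite -(cardC1 (0 : F)) sum1dep_card -(card_imset (mem (predC1 0)) (f := fun c => c *: u)).
  apply: eq_card => v; rewrite !inE; apply/imsetP/idP.
    case=> c; rewrite inE => c0 ->; rewrite scaler_eq0 negb_or c0 u0 /=.
    rewrite diag_formZ (eqP Qu) mulr0 eqxx -(inj_eq val_inj) ptE ?Pu; last first.
      by rewrite scaler_eq0 negb_or c0.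
    by rewrite eq_sym; apply/line_eqP; [rewrite scaler_eq0 negb_or c0|exists c].
  case/andP=> /andP[v0 Qv]; rewrite -(inj_eq val_inj) ptE // Pu eq_sym.
  by case/(line_eqP _ v0) => c c0 ->; exists c.
move=> c c' /eqP; rewrite -subr_eq0 -scalerBl scaler_eq0 (negPf u0) orbF subr_eq0.
by move/eqP.
Qed.

End Diagonal.

(** * Lines meet a diagonal curve in at most [d] points *)

Lemma coef_linear_exp (F : fieldType) (b c : F) d k :
  ((b *: 'X + c%:P) ^+ d)`_k = c ^+ (d - k) * b ^+ k *+ 'C(d, k).
Proof.
rewrite addrC exprDn coef_sum.
under eq_bigr => i _ do
  rewrite exprZn -polyC_exp mul_polyC coefMn !coefZ coefXn.
have [lekd | ltdk] := leqP k d; last first.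
  rewrite bin_small // mulr0n big1 // => i _; rewrite gtn_eqF ?mulr0 ?mul0rn //.
  by apply: leq_ltn_trans ltdk; rewrite -ltnS.
rewrite (bigD1 (inord k)) //= inordK ?ltnS // eqxx mulr1 big1 ?addr0 // => i ne.
rewrite [k == i]negbTE ?mulr0 ?mul0rn //; apply: contraNneq ne => ->.
by apply/eqP/val_inj; rewrite /= inordK.
Qed.

Section LineBound.

Variables (F : finFieldType) (A : 'I_3 -> F) (d : nat).
Hypotheses (A0 : forall i, A i != 0) (d_gt1 : (1 < d)%N) (dF : d%:R != 0 :> F).
Local Notation Q := (diag_form A d).

(** The form restricted to the points [s *: u + w], that is, to the line through [u] and [w] with
    the point [u] left out. *)
Definition pencil_poly (u w : 'rV[F]_3) : {poly F} :=
  \sum_i A i *: (u 0 i *: 'X + (w 0 i)%:P) ^+ d.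

Lemma coef_pencil_poly u w k : (pencil_poly u w)`_k =
  \sum_i A i * (w 0 i ^+ (d - k) * u 0 i ^+ k *+ 'C(d, k)).
Proof.
rewrite coef_sum; apply: eq_bigr => i _.
by rewrite coefZ coef_linear_exp.
Qed.

Lemma horner_pencil_poly u w s : (pencil_poly u w).[s] = Q (s *: u + w).
Proof.
rewrite horner_sum; apply: eq_bigr => i _.
by rewrite !hornerE !mxE [s * _]mulrC.
Qed.

(** The coefficient of degree [d] is [Q u]. When the omitted point [u] lies on the curve, the degree
    bound drops by one, which pays for counting [u] separately. *)
Lemma size_pencil_poly u w : (size (pencil_poly u w) <= d.+1 - (Q u == 0%R))%N.
Proof.
apply/leq_sizeP => k; rewrite coef_pencil_poly leq_subLR addnC.
case: eqP => [Qu | _]; rewrite ?addn1 ?addn0 ?ltnS => lek; last first.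
  by rewrite big1 // => i _; rewrite bin_small ?mulr0n ?mulr0.
have [-> | ne] := eqVneq k d; last first.
  by rewrite big1 // => i _; rewrite bin_small ?mulr0n ?mulr0 // ltn_neqAle eq_sym ne.
rewrite -[RHS]Qu; apply: eq_bigr => i _.
by rewrite subnn expr0 mul1r binn.
Qed.

(** If the polynomial vanished, its coefficient of degree [d] would force [u_k] to be nonzero, then
    degree 1 would give [w_k = 0] because [d] is invertible, and degree 0 would give [w_i = 0], so
    that [w = 0]. The hypothesis on sums encodes that [i], [j], [k] enumerate the coordinates. *)
Lemma pencil_poly_neq0 (i j k : 'I_3) (u w : 'rV[F]_3) :
    (forall f : 'I_3 -> F, \sum_l f l = f i + f j + f k) ->
    u 0 i = 0 -> u 0 j != 0 -> w 0 j = 0 -> w != 0 ->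
  pencil_poly u w != 0.
Proof.
move=> sum3 ui uj wj; apply: contraNneq => G0.
have d0 : (d == 0)%N = false by case: (d) d_gt1.
have coefG m : 'C(d, m)%:R * (A i * (w 0 i ^+ (d - m) * u 0 i ^+ m)
  + A j * (w 0 j ^+ (d - m) * u 0 j ^+ m)
  + A k * (w 0 k ^+ (d - m) * u 0 k ^+ m)) = 0.
  rewrite -[RHS](coef0 _ m) -G0 coef_pencil_poly sum3.
  rewrite -[w 0 i ^+ _ * _ *+ _]mulr_natl -[w 0 j ^+ _ * _ *+ _]mulr_natl.
  by rewrite -[w 0 k ^+ _ * _ *+ _]mulr_natl; ring.
have uk : u 0 k != 0.
  apply/eqP=> uk; have := coefG d; rewrite ui uk binn subnn !expr0 !expr0n d0.
  rewrite !mulr0 add0r addr0 !mul1r => /eqP.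
  by rewrite mulf_eq0 (negPf (A0 j)) expf_eq0 (negPf uj) andbF.
have wk : w 0 k = 0.
  have := coefG 1%N; rewrite ui wj bin1 !expr1 mulr0 expr0n subn_eq0 leqNgt d_gt1.
  rewrite /= mul0r !mulr0 !add0r => /eqP.
  rewrite !mulf_eq0 (negPf dF) (negPf (A0 k)) (negPf uk) orbF expf_eq0 /=.
  by case/andP=> _ /eqP.
have wi : w 0 i = 0.
  have := coefG 0%N; rewrite wj wk subn0 bin0 !expr0 expr0n d0 !mul1r !mulr1.
  rewrite /= !mulr0 !addr0 => /eqP.
  by rewrite mulf_eq0 (negPf (A0 i)) expf_eq0 => /andP[_ /eqP].
apply/eqP/rowP=> m; rewrite mxE.
(* Summing the indicator function of [m] shows that [m] is one of [i], [j], [k]. *)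
have := sum3 (fun l => (l == m)%:R); rewrite (bigD1 m) //= eqxx big1; last first.
  by move=> l /negPf->.
have [<- // | _] := eqVneq i m; have [<- // | _] := eqVneq j m.
have [<- // | _] := eqVneq k m; rewrite !addr0 => /eqP.
by rewrite oner_eq0.
Qed.

(** Gaussian elimination: [u] is obtained by killing coordinate 0, and [w] from an independent
    vector by killing a coordinate where [u] is nonzero. *)
Lemma line_basis (L : proj_line F) : exists u w : 'rV[F]_3, exists j k,
  (forall f : 'I_3 -> F, \sum_l f l = f 0 + f j + f k) /\
  [/\ u 0 0 = 0, u 0 j != 0, w 0 j = 0, w != 0 & val L = (<[u]> + <[w]>)%VS].
Proof.
case: L => L /= /eqP dimL.
have out (x : 'rV[F]_3) : exists2 y, y \in L & y \notin <[x]>%VS.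
  apply/subvPn/negP=> /dimvS; rewrite dimL dim_vline.
  by case: (x != 0).
have [u uL [u0 uN0]] : exists2 u : 'rV[F]_3, u \in L & u 0 0 = 0 /\ u != 0.
  have [x xL x_0] := out 0; have xN0 : x != 0 by apply: contraNneq x_0 => ->; apply: mem0v.
  have [y yL yx] := out x; have [x0 | x0] := eqVneq (x 0 0) 0.
    by exists x.
  exists (y - (y 0 0 / x 0 0) *: x); first by rewrite rpredB ?rpredZ.
  split; first by rewrite !mxE divfK ?subrr.
  by apply: contraNneq yx => /eqP; rewrite subr_eq0 => /eqP->; rewrite rpredZ ?memv_line.
have [y yL yu] := out u.
have [j [k [sum3 uj]]] : exists j k,
    (forall f : 'I_3 -> F, \sum_l f l = f 0 + f j + f k) /\ u 0 j != 0.
  have sum3 (f : 'I_3 -> F) : \sum_l f l = f 0 + f 1 + f 2%:R.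
    rewrite !big_ord_recl big_ord0 addr0 addrA.
    by congr (_ + f _ + f _); apply: val_inj.
  have [u1 | u1] := eqVneq (u 0 1) 0; last by exists 1, 2%:R.
  exists 2%:R, 1; split=> [f|]; first by rewrite addrAC.
  apply: contraNneq uN0 => u2; apply/eqP/rowP=> m; rewrite mxE.
  case: m => [[|[|[|//]]] ltm]; [rewrite -[RHS]u0|rewrite -[RHS]u1|rewrite -[RHS]u2];
    by congr (u _ _); apply: val_inj.
pose w := y - (y 0 j / u 0 j) *: u.
have wu : w \notin <[u]>%VS.
  apply: contra yu => wu.
  by rewrite -[y](subrK ((y 0 j / u 0 j) *: u)) rpredD ?rpredZ ?memv_line.
exists u, w, j, k; split=> //; split=> //; first by rewrite !mxE divfK ?subrr.
  by apply: contraNneq wu => ->; rewrite mem0v.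
have sL : (<[u]> + <[w]> <= L)%VS.
  by rewrite subv_add -!memvE uL rpredB ?rpredZ.
(* If the sum had dimension at most 1, it would coincide with the span of [u], which does not
   contain [w]. *)
apply/esym/eqP; rewrite eqEdim sL dimL ltnNge; apply: contra wu => le1.
have /dimv_leqif_sup le_u := addvSl <[u]> <[w]>.
have := geq_leqif le_u; rewrite dim_vline uN0 le1 => /esym/subvP; apply.
exact: subvP (addvSr _ _) _ (memv_line w).
Qed.

Lemma diag_curve_line (L : proj_line F) :
  (#|[set P in diag_curve A d | on_line P L]| <= d)%N.
Proof.
have [pt ptE] := proj_point_map F.
have [u [w [j [k [sum3 [u0 uj wj w0 LE]]]]]] := line_basis L.
have G0 := pencil_poly_neq0 sum3 u0 uj wj w0.
have uN0 : u != 0 by apply: contraNneq uj => ->; rewrite mxE.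
have suw0 s : s *: u + w != 0.
  apply: contraNneq w0 => suw; have /rowP/(_ j) := suw; rewrite !mxE wj addr0.
  move/eqP; rewrite mulf_eq0 (negPf uj) orbF => /eqP s0.
  by move: suw; rewrite s0 scale0r add0r => ->.
set R := [set s | root (pencil_poly u w) s].
(* The boolean counts the point [u] itself; the roots count the other points of the line. *)
have cardR : (#|R| + (Q u == 0%R) <= d)%N.
  have := leq_trans (max_poly_roots G0 _ (enum_uniq (mem R))) (size_pencil_poly u w).
  rewrite -cardE ltn_subRL addnC ltnS; apply.
  by apply/allP=> s; rewrite mem_enum inE.
apply: leq_trans cardR; rewrite addnC.
have -> : nat_of_bool (Q u == 0) = #|if Q u == 0 then [set pt u] else set0|.
  by case: ifP; rewrite ?cards1 ?cards0.
apply: leq_trans (leq_add (leqnn _) (leq_imset_card (fun s => pt (s *: u + w)) R)).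
apply: leq_trans (leq_card_setU _ _); apply/subset_leq_card/subsetP=> P.
rewrite inE => /andP[PC]; rewrite /on_line LE.
have [v v0 Pv] := proj_pointP P; rewrite Pv -memvE.
case/memv_addP=> _ /vlineP[s ->] [_ /vlineP[t ->] vE].
(* For [t = 0] the point is [u]; otherwise its representative is rescaled so that [w] has
   coefficient 1. *)
rewrite inE; apply/orP; have [t0 | t0] := eqVneq t 0; [left | right].
  have Pu : P = pt u.
    apply/val_inj; rewrite ptE // Pv vE t0 scale0r addr0; apply/eqP.
    rewrite eq_sym; apply/line_eqP; last exists s => //.
      by move: v0; rewrite vE t0 scale0r addr0.
    by apply: contraNneq v0 => s0; rewrite vE s0 t0 !scale0r addr0.
  have -> : Q u == 0 by rewrite -(mem_diag_curve (P := P) A d uN0) // Pu ptE.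
  by rewrite Pu inE.
have Pst : val P = <[(s / t) *: u + w]>%VS.
  rewrite Pv; apply/esym/eqP/line_eqP => //; exists t => //.
  by rewrite vE scalerDr scalerA mulrCA divff // mulr1.
apply/imsetP; exists (s / t); last by apply: val_inj; rewrite ptE.
by rewrite inE /root horner_pencil_poly -(mem_diag_curve A d (suw0 _) Pst).
Qed.

(** * Lines through a vertex of the triangle, and a completeness criterion *)

Lemma vertex_line (i : 'I_3) (v : 'rV[F]_3) : v 0 i = 0 -> v != 0 ->
  exists2 L : proj_line F, val L = (<[v]> + <[delta_mx 0%R i]>)%VS &
    (#|[set t | Q (v + t *: delta_mx 0 i)%R == 0%R]|
       <= #|[set P in diag_curve A d | on_line P L]|)%N.
Proof.
move=> vi v0; have [pt ptE] := proj_point_map F.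
pose e : 'rV[F]_3 := delta_mx 0 i.
have ei : e 0 i = 1 by rewrite mxE !eqxx.
have e0 : e != 0 by apply/eqP=> e0; move/eqP: ei; rewrite e0 mxE eq_sym oner_eq0.
have dimL : \dim (<[v]> + <[e]>) == 2%N.
  rewrite dimv_disjoint_sum ?dim_vline ?v0 ?e0 //.
  apply/eqP; rewrite -subv0; apply/subvP=> x; rewrite memv_cap memv0.
  case/andP=> /vlineP[a xE] /vlineP[b xE']; rewrite xE' in xE *.
  by move/rowP/(_ i): xE; rewrite !mxE vi !eqxx mulr1 mulr0 => ->; rewrite scale0r.
exists (exist (fun U : {vspace _} => \dim U == 2%N) _ dimL) => //.
have vt0 t : v + t *: e != 0.
  apply: contraNneq v0 => vt; have /rowP/(_ i) := vt; rewrite !mxE vi !eqxx.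
  by rewrite mulr1 add0r => t0; move: vt; rewrite t0 scale0r addr0 => ->.
(* A coordinate [m] where [v] is nonzero differs from [i], so it forces the factor [c] between two
   representatives to be 1; coordinate [i] then gives [s = t]. *)
have inj_pt : injective (fun t => pt (v + t *: e)).
  move=> s t /(congr1 val); rewrite !ptE // => /eqP/(line_eqP _ (vt0 t))[c c0].
  move=> eqv; have [m vm] : exists m, v 0 m != 0 by apply/rV0Pn.
  have mi : m != i by apply: contraNneq vm => ->; rewrite vi.
  have c1 : c = 1.
    move/rowP/(_ m): (eqv); rewrite !mxE (negPf mi) andbF !mulr0 !addr0.
    by move=> vE; apply: (mulIf vm); rewrite mul1r.
  by move/rowP/(_ i): eqv; rewrite c1 scale1r !mxE vi !eqxx !mulr1 !add0r.
rewrite -(card_imset (mem [set t | Q (v + t *: e) == 0]) inj_pt).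
apply/subset_leq_card/subsetP=> _ /imsetP[t + ->]; rewrite inE => Qt.
rewrite inE (mem_diag_curve A d (vt0 t)) ?ptE // Qt /on_line /= ptE //.
by rewrite -memvE memv_add ?rpredZ ?memv_line.
Qed.

End LineBound.

(** A larger arc [K'] contains a point [P] outside [K]; the line supplied for [P] already carries
    [d] points of [K], so it meets [K'] in at least [d + 1]. *)
Lemma complete_arc_lines (F : finFieldType) k d (K : {set proj_point F}) :
    is_arc k d K ->
    (forall P, P \notin K ->
       exists2 L, on_line P L & (d <= #|[set R in K | on_line R L]|)%N) ->
  complete_arc k d K.
Proof.
move=> arcK lineK; split=> // K' [cardK' lineK'] sKK'.
have /subsetPn[P PK' PK] : ~~ (K' \subset K).
  by apply/negP=> /subset_leq_card; rewrite cardK' arcK.1 ltnn.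
have [L PL] := lineK P PK; rewrite leqNgt => /negP; apply.
apply: leq_trans (lineK' L); apply: proper_card; apply/properP; split.
  by apply/subsetP=> R; rewrite !inE => /andP[/(subsetP sKK')-> ->].
by exists P; rewrite !inE ?PK' ?(negPf PK).
Qed.

Lemma diag_form_vertex (F : finFieldType) (A : 'I_3 -> F) d i (v : 'rV[F]_3) t :
    (0 < d)%N -> v 0 i = 0 ->
  diag_form A d (v + t *: delta_mx 0 i) = diag_form A d v + A i * t ^+ d.
Proof.
move=> d_gt0 vi; rewrite /diag_form (bigD1 i) // [\sum_j A j * v 0 j ^+ d](bigD1 i) //=.
rewrite !mxE vi !eqxx mulr1 add0r expr0n gtn_eqF // mulr0 add0r addrC.
by congr (_ + _); apply: eq_bigr => j /negPf ij; rewrite !mxE ij andbF mulr0 addr0.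
Qed.

(** * Coordinates and elementary counting *)

Lemma diag_form_coords (F : finFieldType) (A : 'I_3 -> F) d x y z :
  diag_form A d (coords x y z) = A 0 * x ^+ d + A 1 * y ^+ d + A 2%:R * z ^+ d.
Proof.
rewrite /diag_form !big_ord_recl big_ord0 addr0 !mxE addrA /=.
by congr (_ + A _ * _ + A _ * _); apply: val_inj.
Qed.

Lemma card_coords (F : finFieldType) (P : pred 'rV[F]_3) :
  #|P| = #|[set t : F * F * F | P (coords t.1.1 t.1.2 t.2)]|.
Proof.
have coordsK : cancel (fun t : F * F * F => coords t.1.1 t.1.2 t.2)
    (fun v => (v 0 0, v 0 1, v 0 2%:R)).
  by case=> [[x y] z]; rewrite !mxE.
rewrite -(card_imset _ (can_inj coordsK)); apply: eq_card => v.
apply/idP/imsetP => [Pv | [t + ->]]; last by rewrite inE.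
by exists (v 0 0, v 0 1, v 0 2%:R); rewrite ?inE -coords_eta.
Qed.

Lemma card_expr_eq_le (F : finFieldType) m (c : F) :
  (0 < m)%N -> (#|[set x : F | x ^+ m == c]| <= m)%N.
Proof.
move=> m_gt0; have sz := size_XnsubC c m_gt0.
rewrite -ltnS -sz cardE max_poly_roots ?enum_uniq //.
  by rewrite -size_poly_gt0 sz.
by apply/allP=> x; rewrite mem_enum inE /root !hornerE subr_eq0.
Qed.

(** Elements of [P] contribute 1 and the others [d]; the term to subtract stands on the left because
    subtraction of naturals truncates. *)
Lemma sum_if_1_d (T : finType) (P : pred T) d :
  (\sum_x (if P x then 1 else d) + d * #|P| = #|P| + d * #|T|)%N.
Proof.
have -> : #|P| = (\sum_x P x)%N.
  by rewrite -sum1_card big_mkcond; apply: eq_bigr => x _; rewrite unfold_in; case: (P x).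
have -> : #|T| = (\sum_(x : T) 1)%N by rewrite sum1_card.
rewrite !big_distrr -!big_split; apply: eq_bigr => x _ /=; case: (P x); lia.
Qed.

(** * The norm map onto a subfield of a finite field *)

Section Norm.

Variables (F : finFieldType) (K : {set F}) (d : nat).
Hypotheses (divK : GRing.divring_closed [in K])
  (dK : (d * #|K|.-1 = #|F|.-1)%N).

Lemma subfield1 : 1 \in K. Proof. by case: divK. Qed.

Lemma subfieldB x y : x \in K -> y \in K -> x - y \in K.
Proof. by case: divK => _ + _; apply. Qed.

Lemma subfield_div x y : x \in K -> y \in K -> x / y \in K.
Proof. by case: divK => _ _; apply. Qed.

Lemma subfield0 : 0 \in K.
Proof. by rewrite -(subrr 1) subfieldB ?subfield1. Qed.

Lemma subfieldN x : x \in K -> - x \in K.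
Proof. by rewrite -sub0r; apply: subfieldB subfield0. Qed.

Lemma subfieldD x y : x \in K -> y \in K -> x + y \in K.
Proof. by move=> xK yK; rewrite -[y]opprK subfieldB ?subfieldN. Qed.

Lemma subfieldM x y : x \in K -> y \in K -> x * y \in K.
Proof.
by move=> xK yK; rewrite -[y]invrK -[y^-1]div1r !subfield_div ?subfield1.
Qed.

Lemma norm_exponent_gt0 : (0 < d)%N.
Proof.
by move: dK (finNzRing_gt1 F); case: (d) => //; case: #|F| => [|[]].
Qed.

Lemma card_subfieldD1 : #|K :\ 0| = #|K|.-1.
Proof. by rewrite (cardsD1 0 K) subfield0. Qed.

Lemma card_subfield_gt1 : (0 < #|K|.-1)%N.
Proof.
by rewrite -card_subfieldD1; apply/card_gt0P; exists 1; rewrite !inE oner_eq0 subfield1.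
Qed.

(** Multiplication by [x] permutes the units of [K]; compare the products over all units. *)
Lemma subfield_expr x : x \in K -> x != 0 -> x ^+ #|K|.-1 = 1.
Proof.
move=> xK x0; pose U := K :\ 0.
have imU : [set x * y | y in U] = U.
  apply/eqP; rewrite eqEcard card_imset ?leqnn ?andbT; last exact: mulfI.
  apply/subsetP=> _ /imsetP[y /setD1P[y0 yK] ->].
  by rewrite !inE mulf_neq0 ?subfieldM.
have prodU : \prod_(y in U) y != 0.
  by rewrite prodf_seq_neq0; apply/allP=> y _; apply/implyP=> /setD1P[].
apply: (mulIf prodU); rewrite mul1r -{2}imU big_imset /=.
  by rewrite big_split prodr_const card_subfieldD1.
by move=> y z _ _; apply: mulfI.
Qed.

(** The units of [K] are [#|K| - 1] solutions of an equation of that degree, hence all of them. *)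
Lemma subfieldP x : x != 0 -> (x \in K) = (x ^+ #|K|.-1 == 1).
Proof.
move=> x0; have /eqP/setP/(_ x) : K :\ 0 == [set y | y ^+ #|K|.-1 == 1].
  rewrite eqEcard card_subfieldD1 card_expr_eq_le ?card_subfield_gt1 // andbT.
  by apply/subsetP=> y /setD1P[y0 yK]; rewrite inE subfield_expr.
by rewrite !inE x0.
Qed.

Lemma expr_unit_card (x : F) : x != 0 -> x ^+ #|F|.-1 = 1.
Proof.
move=> x0; apply: (mulfI x0); rewrite mulr1 -exprS prednK ?expf_card //.
exact: ltnW (finNzRing_gt1 F).
Qed.

(** For [x] nonzero, raising [x ^+ d] to the power [#|K| - 1] gives [x ^+ #|F|.-1 = 1], the
    criterion of [subfieldP]. *)
Lemma norm_subfield x : x ^+ d \in K.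
Proof.
have [->|x0] := eqVneq x 0; first by rewrite expr0n gtn_eqF ?norm_exponent_gt0 ?subfield0.
by rewrite subfieldP ?expf_neq0 // -exprM dK expr_unit_card.
Qed.

(* The fibres over the [#|K| - 1] units of [K] partition the
   [d * (#|K| - 1)] units of [F] and have at most [d] elements each. *)
Lemma card_norm_fibre c : c \in K -> c != 0 -> #|[set t : F | t ^+ d == c]| = d.
Proof.
move=> cK c0.
have le_d (y : F) : y \in K :\ 0 ->
    (#|[set t : F | t ^+ d == y]| <= d ?= iff (#|[set t : F | t ^+ d == y]| == d))%N.
  by move=> _; split=> //; apply/card_expr_eq_le/norm_exponent_gt0.
have [_ sumE] := leqif_sum le_d; apply/eqP.
have: [forall (y | y \in K :\ 0), #|[set t : F | t ^+ d == y]| == d].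
  rewrite -sumE sum_nat_const card_subfieldD1 mulnC dK -(cardC1 (0 : F)).
  apply/eqP; rewrite -sum1_card [RHS](partition_big (fun t => t ^+ d) [in K :\ 0]) /=.
    apply: eq_bigr => y /setD1P[y0 _]; rewrite sum1dep_card.
    apply: eq_card => t; rewrite !inE; case: eqP => [ty | _]; last by rewrite andbF.
    by move: y0; rewrite andbT -ty expf_eq0 norm_exponent_gt0 => ->.
  by move=> t; rewrite !inE => t0; rewrite expf_neq0 // norm_subfield.
by move/forall_inP; apply; rewrite !inE c0.
Qed.

(** For [s = 0] only [t = 0] remains; otherwise the equation prescribes the norm of [t] to be the
    unit [- s / c] of [K]. *)
Lemma card_norm_affine s c : s \in K -> c \in K -> c != 0 ->
  #|[set t : F | s + c * t ^+ d == 0]| = if s == 0 then 1%N else d.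
Proof.
move=> sK cK c0; case: eqP => [-> | /eqP s0].
  rewrite -(cards1 (0 : F)); apply: eq_card => t; rewrite !inE add0r mulf_eq0.
  by rewrite (negPf c0) expf_eq0 norm_exponent_gt0.
rewrite -[RHS](@card_norm_fibre (- s / c)); last 2 first.
- by rewrite subfield_div ?subfieldN.
- by rewrite mulf_neq0 ?oppr_eq0 ?invr_eq0.
apply: eq_card => t; rewrite !inE -[RHS](inj_eq (mulfI c0)).
by rewrite [c * (_ / _)]mulrC divfK // addrC addr_eq0.
Qed.

End Norm.

(** * The norm curve of (1): point count and completeness *)

Lemma vertex_line_through (F : finFieldType) (A : 'I_3 -> F) d i
    (P : proj_point F) (v : 'rV[F]_3) c t :
    v 0 i = 0 -> v != 0 -> val P = <[c *: v + t *: delta_mx 0%R i]>%VS ->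
    (d <= #|[set s | diag_form A d (v + s *: delta_mx 0 i)%R == 0%R]|)%N ->
  exists2 L, on_line P L &
    (d <= #|[set R in diag_curve A d | on_line R L]|)%N.
Proof.
move=> vi v0 PE le_d; have [L LE leL] := vertex_line A d vi v0.
exists L; last exact: leq_trans le_d leL.
by rewrite /on_line LE PE -memvE memv_add ?rpredZ ?memv_line.
Qed.

Lemma diag_form0 (F : finFieldType) (A : 'I_3 -> F) d :
  (0 < d)%N -> diag_form A d 0 = 0.
Proof.
by case: d => // d _; rewrite /diag_form big1 // => i _; rewrite mxE expr0n mulr0.
Qed.

Lemma complete_arc_norm (F : finFieldType) (K : {set F}) d (A : 'I_3 -> F) :
    GRing.divring_closed [in K] -> (d * #|K|.-1 = #|F|.-1)%N ->
    (1 < d)%N -> d%:R != 0 :> F -> 2%:R != 0 :> F ->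
    (forall i, A i \in K) -> (forall i, A i != 0) ->
  complete_arc (d * (#|F| - d + 2)) d (diag_curve A d).
Proof.
move=> divK dK d_gt1 dF twoF AK A0; have d_gt0 := ltnW d_gt1.
have termK i (x : F) : A i * x ^+ d \in K.
  by apply: (subfieldM divK); [apply: AK | apply: (norm_subfield divK dK)].
have formK v : diag_form A d v \in K.
  apply: (big_ind (fun x => x \in K)) => //; first exact: subfield0 divK.
  exact: subfieldD divK.
apply: complete_arc_lines => [|P PC].
  split; last exact: diag_curve_line.
  have F_gt1 := finNzRing_gt1 F.
  have d_lt : (d <= #|F|.-1)%N by rewrite -dK leq_pmulr ?card_subfield_gt1.
  have F1_gt0 : (0 < #|F|.-1)%N by rewrite -subn1 subn_gt0.
  apply/eqP; rewrite -(eqn_pmul2r F1_gt0) card_diag_curve; apply/eqP.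
  set N := #|_|.
  have NE : N.+1 = #|[pred v : 'rV[F]_3 | diag_form A d v == 0]|.
    rewrite (cardD1 0) inE /= diag_form0 // eqxx add1n; congr _.+1.
    by apply: eq_card => v; rewrite !inE.
  (* For fixed [x] there is one [y] if [x = 0] and there are [d] otherwise, so the binary form has
     [1 + d * (#|F| - 1)] zeros. *)
  have count1 : #|[pred t : F * F | A 0 * t.1 ^+ d + A 1 * t.2 ^+ d == 0]| =
      (\sum_(x : F) if x == 0%R then 1 else d)%N.
    rewrite -sum1_card -(pair_big_dep predT
      (fun x y => A 0 * x ^+ d + A 1 * y ^+ d == 0) (fun _ _ => 1%N)) /=.
    apply: eq_bigr => x _; rewrite sum1dep_card (card_norm_affine divK dK) //.
    by rewrite mulf_eq0 (negPf (A0 0)) expf_eq0 d_gt0.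
  (* A zero of the binary form extends to a zero of the ternary form in one way, every other pair in
     [d] ways. *)
  have count2 : #|[pred v : 'rV[F]_3 | diag_form A d v == 0]| =
      (\sum_(t : F * F) if (A 0 * t.1 ^+ d + A 1 * t.2 ^+ d == 0)%R then 1 else d)%N.
    rewrite card_coords -sum1dep_card /=.
    rewrite -(pair_big_dep predT
      (fun t z => diag_form A d (coords t.1 t.2 z) == 0) (fun _ _ => 1%N)) /=.
    apply: eq_bigr => t _; rewrite -(card_norm_affine divK dK _ (AK 2%:R)) //.
      rewrite sum1dep_card; apply: eq_card => z.
      by rewrite !inE diag_form_coords.
    exact: subfieldD divK _ _ (termK _ _) (termK _ _).
  have := sum_if_1_d (fun x : F => x == 0) d.
  have := sum_if_1_d (fun t : F * F => A 0 * t.1 ^+ d + A 1 * t.2 ^+ d == 0) d.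
  rewrite -count1 -count2 card1 card_prod -NE.
  set N0 := #|_| => eN eN0; move: d_lt eN eN0 F1_gt0.
  have [m ->] : exists m, #|F| = m.+1 by exists #|F|.-1; rewrite prednK ?(ltnW F_gt1).
  (* Writing [#|F| - 1 = r + d] removes the truncated subtraction before the arithmetic. *)
  rewrite /= => /subnK; set r := (m - d)%N => <- eN eN0 _.
  have {}eN0 : N0 = (1 + d * (r + d))%N by lia.
  have -> : ((r + d).+1 - d = r.+1)%N by lia.
  by rewrite eN0 in eN; nia.
have [g g0 PE] := proj_pointP P.
have Qg : diag_form A d g != 0 by rewrite -(mem_diag_curve A d g0 PE).
(* [v i] is the projection of [g] from the vertex [e_i] to the opposite side. *)
pose v i := g - g 0 i *: delta_mx 0 i.
have vi i : v i 0 i = 0 by rewrite !mxE !eqxx mulr1 subrr.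
have gE i : g = v i + g 0 i *: delta_mx 0 i by rewrite subrK.
(* If the form vanished at every [v i], each term of Q(g) would equal Q(g), so Q(g) = 3 Q(g),
   although 2 and Q(g) are nonzero. *)
have [i Qv] : exists i, diag_form A d (v i) != 0.
  apply/existsP; rewrite -negb_forall; apply: contra Qg => /forallP Qv0.
  have QgE i : A i * g 0 i ^+ d = diag_form A d g.
    by rewrite [in RHS](gE i) diag_form_vertex // (eqP (Qv0 i)) add0r.
  have : diag_form A d g = 3%:R * diag_form A d g.
    by rewrite {1}/diag_form (eq_bigr _ (fun i _ => QgE i)) sumr_const card_ord mulr_natl.
  move/eqP; rewrite -subr_eq0 -[X in X - _]mul1r -mulrBl mulf_eq0.
  case/orP=> // /eqP eq31; case/negP: twoF; rewrite -oppr_eq0 -eq31; apply/eqP.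
  by ring.
apply: (@vertex_line_through _ _ _ i _ (v i) 1 (g 0 i)) => //.
- by apply: contraNneq Qv => ->; rewrite diag_form0.
- by rewrite scale1r -gE.
have := card_norm_affine divK dK (formK (v i)) (AK i) (A0 i).
rewrite (negPf Qv) => cardT; rewrite -[X in (X <= _)%N]cardT.
by apply/subset_leq_card/subsetP=> t; rewrite !inE diag_form_vertex.
Qed.

(** * The curve of (2) as the complement of the coordinate triangle *)

Lemma ord3_cover (i j k l : 'I_3) :
  i != j -> i != k -> j != k -> [|| l == i, l == j | l == k].
Proof.
case: i j k l => [i lti] [j ltj] [k ltk] [l ltl]; rewrite -!val_eqE /=; lia.
Qed.

Definition weights112 (F : finFieldType) (i : 'I_3) : F :=
  [:: 1; 1; - 2%:R]`_i.

Lemma weights112_neq0 (F : finFieldType) i :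
  2%:R != 0 :> F -> weights112 F i != 0.
Proof.
rewrite /weights112 => two; case: i => [[|[|[|//]]] lti] /=;
  by rewrite ?oner_eq0 ?oppr_eq0.
Qed.

Lemma expr_card_pred (F : finFieldType) (x : F) :
  x ^+ #|F|.-1 = (x != 0)%:R.
Proof.
have F_gt1 := finNzRing_gt1 F.
have [-> | x0] := eqVneq x 0; last by rewrite expr_unit_card.
by rewrite expr0n gtn_eqF // -subn1 subn_gt0.
Qed.

Lemma forall_coords_neq0 (F : finFieldType) (v : 'rV[F]_3) :
  [forall i, v 0 i != 0] = [&& v 0 0 != 0, v 0 1 != 0 & v 0 2%:R != 0].
Proof.
apply/forallP/and3P => [vN0 | [v0 v1 v2] i]; first by rewrite !vN0.
by have /or3P[] := @ord3_cover 0 1 2%:R i isT isT isT => /eqP->.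
Qed.

(** The power [#|F| - 1] sends 0 to 0 and units to 1, which leaves eight cases: nonzero triples with
    a zero coordinate give 1, 2, -1 or -2, nonzero since 2 is, while triples of units give 1 + 1 - 2
    = 0. *)
Lemma diag_form112_eq0 (F : finFieldType) (v : 'rV[F]_3) :
    2%:R != 0 :> F -> v != 0 ->
  (diag_form (weights112 F) #|F|.-1 v == 0) = [forall i, v 0 i != 0].
Proof.
move=> two v0.
rewrite forall_coords_neq0 {1}(coords_eta v) diag_form_coords !expr_card_pred.
rewrite /weights112 /=.
have [x0 | _] := eqVneq (v 0 0) 0; have [y0 | _] := eqVneq (v 0 1) 0;
have [z0 | _] := eqVneq (v 0 2%:R) 0; rewrite ?(mulr0, mulr1, addr0, add0r) /=.
- case/eqP: v0; rewrite [v]coords_eta x0 y0 z0.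
  by apply/rowP=> i; rewrite !mxE; case: i => [[|[|[|]]] ].
- by rewrite oppr_eq0 (negPf two).
- by rewrite oner_eq0.
- by rewrite (_ : 1 - 2%:R = -1) ?oppr_eq0 ?oner_eq0 //; ring.
- by rewrite oner_eq0.
- by rewrite (_ : 1 - 2%:R = -1) ?oppr_eq0 ?oner_eq0 //; ring.
- by rewrite (_ : 1 + 1 = 2%:R) ?(negPf two) //; ring.
by rewrite (_ : 1 + 1 - 2%:R = 0) ?eqxx //; ring.
Qed.

Lemma complete_arc_torus (F : finFieldType) : 2%:R != 0 :> F -> (2 < #|F|)%N ->
    #|F|%:R = 0 :> F ->
  complete_arc (#|F|.-1 ^ 2) #|F|.-1 (diag_curve (weights112 F) #|F|.-1).
Proof.
move=> two F_gt2 F0; set r := #|F|.-1; set A := weights112 F.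
have F_gt1 := ltnW F_gt2; have FE : #|F| = r.+1 by rewrite prednK // ltnW.
have r_gt1 : (1 < r)%N by rewrite -ltnS -FE.
have r_gt0 := ltnW r_gt1.
have units : #|[set x : F | x != 0]| = r.
  by rewrite /r -(cardC1 (0 : F)); apply: eq_card => x; rewrite !inE.
(* [r] is -1 in [F], since [#|F|] vanishes there. *)
have rF : r%:R != 0 :> F.
  by rewrite -(addrK 1 r%:R) natr1 -FE F0 sub0r oppr_eq0 oner_eq0.
have rv0 (x : 'rV[F]_3) j : x 0 j != 0 -> x != 0.
  by apply: contraNneq => ->; rewrite mxE.
apply: complete_arc_lines => [|P PC].
  split; last by apply: diag_curve_line => // i; apply: weights112_neq0.
  apply/eqP; rewrite -(eqn_pmul2r r_gt0) card_diag_curve -expnSr; apply/eqP.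
  rewrite cardsE card_coords.
  transitivity #|setX (setX [set x : F | x != 0] [set x : F | x != 0]) [set x : F | x != 0]|.
    apply: eq_card => -[[x y] z]; rewrite !inE /=.
    have [v0 | v0] := eqVneq (coords x y z) 0; last first.
      by rewrite diag_form112_eq0 // forall_coords_neq0 !mxE -[RHS]andbA.
    by have /rowP/(_ 0) := v0; rewrite !mxE /= => ->; rewrite eqxx.
  by rewrite !cardsX units !expnS expn0 muln1 mulnA.
have [g g0 PE] := proj_pointP P.
have := PC; rewrite (mem_diag_curve A r g0 PE) diag_form112_eq0 //.
rewrite negb_forall => /existsP[j]; rewrite negbK => /eqP gj.
(* Each nonzero [s] fills the only zero coordinate of [v] and so yields a point of the curve. *)
have enough i (v : 'rV[F]_3) : v 0 i = 0 -> (forall l, l != i -> v 0 l != 0) ->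
    (r <= #|[set s | diag_form A r (v + s *: delta_mx 0 i)%R == 0%R]|)%N.
  move=> vi vl; rewrite -{1}units; apply/subset_leq_card/subsetP=> s.
  rewrite !inE => s0; have vsi : (v + s *: delta_mx 0 i) 0 i != 0.
    by rewrite !mxE vi !eqxx mulr1 add0r.
  rewrite diag_form112_eq0 ?(rv0 _ _ vsi) //; apply/forallP=> l.
  have [-> // | li] := eqVneq l i.
  by rewrite !mxE (negPf li) andbF mulr0 addr0 vl.
(* If [j] is the only zero coordinate, the line joining [P] to the vertex [e_j] serves. *)
have [gl | ] := boolP [forall (l | l != j), g 0 l != 0].
  apply: (@vertex_line_through _ _ _ j _ g 1 0) => //.
    by rewrite scale1r scale0r addr0.
  by apply: enough => // l; move/forall_inP: gl; apply.
rewrite negb_forall_in => /exists_inP[m mj]; rewrite negbK => /eqP gm.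
have [k gk] := rV0Pn _ g0.
(* With two zero coordinates, [P] is the vertex [e_k] itself. The line may then go through any point
   of the opposite side that is not a vertex; this [v] is one, and [P] has coefficient 0 along
   it. *)
pose v : 'rV[F]_3 := const_mx 1 - delta_mx 0 k.
have vk : v 0 k = 0 by rewrite !mxE !eqxx subrr.
have vl l : l != k -> v 0 l != 0.
  by move/negPf=> lk; rewrite !mxE lk andbF subr0 oner_eq0.
have jk : j != k by apply: contraNneq gk => <-; rewrite gj.
have mk : m != k by apply: contraNneq gk => <-; rewrite gm.
apply: (@vertex_line_through _ _ _ k _ v 0 (g 0 k)) => //.
- exact: rv0 (vl j jk).
- rewrite scale0r add0r PE; congr <[_]>%VS; apply/rowP=> l; rewrite !mxE eqxx /=.
  case/or3P: (ord3_cover l mj mk jk) => /eqP->; rewrite ?gm ?gj ?eqxx ?mulr1 //.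
    by rewrite (negPf mk) mulr0.
  by rewrite (negPf jk) mulr0.
- exact: enough.
Qed.

(** * Both families of arcs *)

Theorem theorem1p1 (p : nat) (hp : prime p) (hp3 : (3 <= p)%N) :
  (forall (n e : nat), (0 < n)%N -> (0 < e)%N -> (e < n)%N -> (e %| n)%N ->
   forall (F : finFieldType) (K : {set F}),
     #|F| = (p ^ n)%N ->
     GRing.divring_closed [in K] -> #|K| = (p ^ e)%N ->
   forall a b : F, a \in K -> a != 0 -> b \in K -> b != 0 ->
     let q := (p ^ n)%N in
     let q' := (p ^ e)%N in
     let d := ((q - 1) %/ (q' - 1))%N in
     let k := (d * (q - d + 2))%N in
     complete_arc k d
       (rational_points
          (fun x y z : F => a * x ^+ d + b * y ^+ d + z ^+ d == 0)))
  /\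
  (forall n : nat, (0 < n)%N ->
   forall F : finFieldType,
     #|F| = (p ^ n)%N ->
     let q := (p ^ n)%N in
     complete_arc ((q - 1) ^ 2)%N (q - 1)%N
       (rational_points
          (fun x y z : F =>
             x ^+ (q - 1) + y ^+ (q - 1) == 2%:R * z ^+ (q - 1)))).
Proof.
have charP n (F : finFieldType) : (0 < n)%N -> #|F| = (p ^ n)%N ->
    #|F|%:R = 0 :> F /\ 2%:R != 0 :> F.
  move=> n_gt0 cardF; have charF := card_finPcharP cardF hp.
  split; first by apply/eqP; rewrite -(dvdn_pcharf charF) cardF dvdn_exp.
  by rewrite -(dvdn_pcharf charF) gtnNdvd.
split=> [n e n_gt0 e_gt0 lt_en dv_en F K cardF divK cardK a b aK a0 bK b0 | n n_gt0 F cardF].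
  move=> q q' d k; have [F0 two] := charP n F n_gt0 cardF.
  have p_gt1 := prime_gt1 hp.
  have q'_gt1 : (1 < q')%N by rewrite -(expn0 p) ltn_exp2l.
  have lt_q'q : (q' < q)%N by rewrite ltn_exp2l.
  (* [q] is a power of [q'], so [q' - 1] divides [q - 1] and the quotient [d] is exact. *)
  have dq : (d * (q' - 1) = q - 1)%N.
    rewrite divnK //; have /dvdnP[m nE] := dv_en.
    by rewrite /q nE mulnC expnM -/q' !subn1 predn_exp dvdn_mulr.
  have dK : (d * #|K|.-1 = #|F|.-1)%N by rewrite cardK cardF -!subn1.
  have d_gt1 : (1 < d)%N by nia.
  (* If [d] vanished in [F], then [q = d * (q' - 1) + 1] would be both 0 and 1 there. *)
  have dF : d%:R != 0 :> F.
    apply/eqP=> d0; move: F0; rewrite cardF -/q -(subnK (ltnW (ltn_trans q'_gt1 lt_q'q))).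
    by rewrite -dq natrD natrM d0 mul0r add0r => /eqP; rewrite oner_eq0.
  pose A (i : 'I_3) := [:: a; b; 1]`_i.
  rewrite (@rational_points_diag F A d).
    rewrite /k /q -cardF; apply: (complete_arc_norm divK dK d_gt1 dF two) => i.
      by rewrite /A; case: i => [[|[|[|//]]] lti] //=; apply: subfield1 divK.
    by rewrite /A; case: i => [[|[|[|//]]] lti] //=; apply: oner_neq0.
  by move=> x y z; rewrite diag_form_coords /A /= mul1r.
move=> q; have [F0 two] := charP n F n_gt0 cardF.
rewrite (@rational_points_diag F (weights112 F) (q - 1)).
  rewrite subn1 /q -cardF; apply: complete_arc_torus two _ F0.
  by rewrite cardF (leq_trans hp3) // -{1}(expn1 p) leq_exp2l ?prime_gt1.
move=> x y z; rewrite diag_form_coords /weights112 /= !mul1r mulNr.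
by rewrite subr_eq0.
Qed.
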